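(* A formula $A$ is provable in Int2GC if and only if $A$ is Kripke-valid, i.e. valid in every Int2GC-frame.
   Context: Formulas are built from a countably infinite set $\mathrm{Var}$ of propositional variables with the connectives $\neg,\vee,\wedge,\to$ and four unary connectives $\blacktriangle,\blacktriangledown,\vartriangle,\triangledown$. The logic Int2GC is the smallest set of formulas (called provable formulas) that contains intuitionistic propositional logic (in this language) and is closed under substitution, modus ponens, and the four rules: from $A\to\triangledown B$ infer $\blacktriangle A\to B$; from $\blacktriangle A\to B$ infer $A\to\triangledown B$; from $A\to\blacktriangledown B$ infer $\vartriangle A\to B$; from $\vartriangle A\to B$ infer $A\to\blacktriangledown B$. For binary relations, $x\,(R\circ S)\,y$ means that there is $z$ with $x\,R\,z$ and $z\,S\,y$; $\ge$ is the inverse of $\le$. An Int2GC-frame is a quadruple $(X,\le,R_1,R_2)$ where $X$ is a non-empty set, $\le$ is a preorder on $X$, and $R_1,R_2$ are binary relations on $X$ with $({\ge}\circ R_1\circ{\ge})\subseteq R_1$ and $({\le}\circ R_2\circ{\le})\subseteq R_2$. A valuation on the frame is a map $v\colon\mathrm{Var}\to\wp(X)$ such that $x\in v(p)$ and $x\le y$ imply $y\in v(p)$; a frame with a valuation is a model. Satisfaction in a model is defined by: $x\models p$ iff $x\in v(p)$; $x\models A\wedge B$ iff $x\models A$ and $x\models B$; $x\models A\vee B$ iff $x\models A$ or $x\models B$; $x\models A\to B$ iff for all $y\ge x$, $y\models A$ implies $y\models B$; $x\models\neg A$ iff for no $y\ge x$ does $y\models A$; $x\models\blacktriangle A$ iff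 there is $y$ with $x\,R_1\,y$ and $y\models A$; $x\models\triangledown A$ iff for all $y$, $y\,R_1\,x$ implies $y\models A$; $x\models\vartriangle A$ iff there is $y$ with $y\,R_2\,x$ and $y\models A$; $x\models\blacktriangledown A$ iff for all $y$, $x\,R_2\,y$ implies $y\models A$. A formula is valid in a frame if it is satisfied at every point of every model based on the frame. *)

(* Defs.v *)
From Stdlib Require Import Relations.

Definition var : Set := nat.

(* [BUp], [BDown], [WUp], [WDown] are the connectives written with a black
   upward, black downward, white upward and white downward triangle. *)
Inductive form : Set :=
| Var (p : var)
| Neg (A : form)
| Or (A B : form)
| And (A B : form)
| Imp (A B : form)
| BUp (A : form)
| BDown (A : form)
| WUp (A : form)
| WDown (A : form).

Fixpoint subst (s : var -> form) (A : form) : form :=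
  match A with
  | Var p => s p
  | Neg A => Neg (subst s A)
  | Or A B => Or (subst s A) (subst s B)
  | And A B => And (subst s A) (subst s B)
  | Imp A B => Imp (subst s A) (subst s B)
  | BUp A => BUp (subst s A)
  | BDown A => BDown (subst s A)
  | WUp A => WUp (subst s A)
  | WDown A => WDown (subst s A)
  end.

(* A Hilbert system with primitive negation. The schemes range over the full
   language, so formulas headed by a triangle behave as additional atoms. *)
Inductive IPL : form -> Prop :=
| ipl_k A B : IPL (Imp A (Imp B A))
| ipl_s A B C :
    IPL (Imp (Imp A (Imp B C)) (Imp (Imp A B) (Imp A C)))
| ipl_and_l A B : IPL (Imp (And A B) A)
| ipl_and_r A B : IPL (Imp (And A B) B)
| ipl_and_i A B : IPL (Imp A (Imp B (And A B)))
| ipl_or_l A B : IPL (Imp A (Or A B))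
| ipl_or_r A B : IPL (Imp B (Or A B))
| ipl_or_e A B C :
    IPL (Imp (Imp A C) (Imp (Imp B C) (Imp (Or A B) C)))
| ipl_neg_i A B : IPL (Imp (Imp A B) (Imp (Imp A (Neg B)) (Neg A)))
| ipl_neg_e A B : IPL (Imp (Neg A) (Imp A B))
| ipl_mp A B : IPL (Imp A B) -> IPL A -> IPL B.

Inductive Int2GC : form -> Prop :=
| int2gc_ipl A : IPL A -> Int2GC A
| int2gc_subst s A : Int2GC A -> Int2GC (subst s A)
| int2gc_mp A B : Int2GC (Imp A B) -> Int2GC A -> Int2GC B
| int2gc_bup_i A B : Int2GC (Imp A (WDown B)) -> Int2GC (Imp (BUp A) B)
| int2gc_wdown_i A B : Int2GC (Imp (BUp A) B) -> Int2GC (Imp A (WDown B))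
| int2gc_wup_i A B : Int2GC (Imp A (BDown B)) -> Int2GC (Imp (WUp A) B)
| int2gc_bdown_i A B : Int2GC (Imp (WUp A) B) -> Int2GC (Imp A (BDown B)).

Definition rel_comp {X : Type} (R S : relation X) : relation X :=
  fun x y => exists z, R x z /\ S z y.

Record frame : Type := Frame {
  world : Type;
  world_nonempty : inhabited world;
  le : relation world;
  R1 : relation world;
  R2 : relation world;
  le_preorder : preorder world le;
  R1_closed :
    inclusion world
      (rel_comp (rel_comp (transp world le) R1) (transp world le)) R1;
  R2_closed : inclusion world (rel_comp (rel_comp le R2) le) R2
}.

Record valuation (F : frame) : Type := Valuation {
  val : var -> world F -> Prop;
  val_mono : forall p x y, val p x -> le F x y -> val p y
}.

Arguments val {F} v p x : rename.

Fixpoint sat (F : frame) (v : valuation F) (x : world F) (A : form) : Prop :=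
  match A with
  | Var p => val v p x
  | Neg A => forall y, le F x y -> ~ sat F v y A
  | Or A B => sat F v x A \/ sat F v x B
  | And A B => sat F v x A /\ sat F v x B
  | Imp A B => forall y, le F x y -> sat F v y A -> sat F v y B
  | BUp A => exists y, R1 F x y /\ sat F v y A
  | BDown A => forall y, R2 F x y -> sat F v y A
  | WUp A => exists y, R2 F y x /\ sat F v y A
  | WDown A => forall y, R1 F y x -> sat F v y A
  end.

Definition valid_in (F : frame) (A : form) : Prop :=
  forall (v : valuation F) (x : world F), sat F v x A.

Definition kripke_valid (A : form) : Prop := forall F : frame, valid_in F A.

(* Main.v *)
(** Completeness uses the canonical model on prime theories ordered by
    inclusion.  The rules make [BUp], [WDown] and [WUp], [BDown] two adjoint
    pairs, and an adjoint pair [f], [g] is interpreted by the relation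
    "[f B] is in [x] for every [B] in [y]", equivalently "[B] is in [x]
    whenever [g B] is in [y]".  Since [f] preserves disjunctions, the formulas
    [B] with [f B] outside a prime theory form an ideal, and separating a theory
    from an ideal by a prime theory yields the witness for [f A]; that [g]
    preserves implications yields the one against [g A]. *)

From Stdlib Require Import Relations Classical Cantor.
Require Import Defs.

(** * Soundness *)

Lemma sat_mono (F : frame) (v : valuation F) (A : form) :
  forall x y, le F x y -> sat F v x A -> sat F v y A.
Proof.
  destruct (le_preorder F) as [le_refl le_trans].
  induction A as [p|A IHA|A IHA B IHB|A IHA B IHB|A IHA B IHB
                 |A IHA|A IHA|A IHA|A IHA]; simpl; intros x y xy.
  - intros Hx. exact (val_mono F v p x y Hx xy).
  - intros Hx z yz. exact (Hx z (le_trans x y z xy yz)).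
  - intros [Hx|Hx]; [left|right]; eauto.
  - intros [HA HB]; split; eauto.
  - intros Hx z yz. exact (Hx z (le_trans x y z xy yz)).
  (* In the four triangle cases the closure condition is applied with the step [x <= y] on one side
     of the relation and reflexivity on the other. *)
  - intros (z & xz & Hz). exists z. split; [|exact Hz].
    apply R1_closed. exists z. split; [|apply le_refl].
    exists x. split; assumption.
  - intros Hx z yz. apply Hx. apply R2_closed.
    exists z. split; [|apply le_refl]. exists y. split; assumption.
  - intros (z & zx & Hz). exists z. split; [|exact Hz].
    apply R2_closed. exists x. split; [|exact xy].
    exists z. split; [apply le_refl|exact zx].
  - intros Hx z zy. apply Hx. apply R1_closed.
    exists y. split; [|exact xy]. exists z. split; [apply le_refl|exact zy].
Qed.

Lemma IPL_sat (F : frame) (v : valuation F) (A : form) :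
  IPL A -> forall x, sat F v x A.
Proof.
  destruct (le_preorder F) as [le_refl le_trans].
  intros HA. induction HA; simpl; intros x.
  - intros y _ HA z yz _. exact (sat_mono F v A y z yz HA).
  - intros y _ HABC z yz HAB w zw HA.
    apply (HABC w (le_trans _ _ _ yz zw) HA w (le_refl w)).
    exact (HAB w zw HA).
  - tauto.
  - tauto.
  - intros y _ HA z yz HB. split; [exact (sat_mono F v A y z yz HA)|exact HB].
  - tauto.
  - tauto.
  - intros y _ HAC z yz HBC w zw [HA|HB]; eauto.
  - intros y _ HAB z yz HAnB w zw HA.
    exact (HAnB w zw HA w (le_refl w) (HAB w (le_trans _ _ _ yz zw) HA)).
  - intros y _ HnA z yz HA. destruct (HnA z yz HA).
  - exact (IHHA1 x x (le_refl x) (IHHA2 x)).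
Qed.

Definition subst_valuation (F : frame) (v : valuation F) (s : var -> form) :
  valuation F :=
  Valuation F (fun p x => sat F v x (s p))
    (fun p x y Hx xy => sat_mono F v (s p) x y xy Hx).

Lemma sat_subst (F : frame) (v : valuation F) (s : var -> form) (A : form) :
  forall x, sat F v x (subst s A) <-> sat F (subst_valuation F v s) x A.
Proof.
  induction A; simpl; intros x; try solve [firstorder]; reflexivity.
Qed.

Lemma soundness (A : form) : Int2GC A -> kripke_valid A.
Proof.
  intros HA F. destruct (le_preorder F) as [le_refl _].
  (* The valuation stays quantified: the substitution rule uses the induction hypothesis at
     [subst_valuation]. *)
  induction HA as [A HA|s A _ IH|A B _ IHAB _ IHA|A B _ IH|A B _ IH
                  |A B _ IH|A B _ IH]; intros v x.
  - exact (IPL_sat F v A HA x).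
  - apply sat_subst, IH.
  - exact (IHAB v x x (le_refl x) (IHA v x)).
  - simpl. intros y _ (z & yz & Hz). exact (IH v z z (le_refl z) Hz y yz).
  - simpl. intros y _ Hy z zy. apply (IH v z z (le_refl z)).
    exists y. split; assumption.
  - simpl. intros y _ (z & zy & Hz). exact (IH v z z (le_refl z) Hz y zy).
  - simpl. intros y _ Hy z yz. apply (IH v z z (le_refl z)).
    exists y. split; assumption.
Qed.

(** * Theories, prime theories and ideals *)

(** Closure is under modus ponens alone: the triangle rules preserve provability, but not truth at a
    single world. *)
Record theory (T : form -> Prop) : Prop := {
  theory_thm : forall A, Int2GC A -> T A;
  theory_mp : forall A B, T (Imp A B) -> T A -> T B
}.

Record prime (T : form -> Prop) : Prop := {
  prime_theory : theory T;
  prime_or : forall A B, T (Or A B) -> T A \/ T B;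
  prime_proper : exists A, ~ T A
}.

(** An ideal for the preorder of provable implication, possibly empty; [separation] asks for a
    member separately. *)
Record ideal (I : form -> Prop) : Prop := {
  ideal_down : forall A B, Int2GC (Imp A B) -> I B -> I A;
  ideal_or : forall A B, I A -> I B -> I (Or A B)
}.

Section Theory.

Variables (T : form -> Prop) (HT : theory T).

Lemma theory_ipl A : IPL A -> T A.
Proof. intros HA. apply (theory_thm T HT), int2gc_ipl, HA. Qed.

Lemma theory_weaken A B : T B -> T (Imp A B).
Proof. apply (theory_mp T HT), theory_ipl, ipl_k. Qed.

Lemma theory_imp_mp A B C : T (Imp A (Imp B C)) -> T (Imp A B) -> T (Imp A C).
Proof.
  intros H. apply (theory_mp T HT). revert H.
  apply (theory_mp T HT), theory_ipl, ipl_s.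
Qed.

Lemma theory_imp_refl A : T (Imp A A).
Proof.
  apply (theory_imp_mp A (Imp A A)); apply theory_ipl, ipl_k.
Qed.

Lemma theory_imp_trans A B C : T (Imp A B) -> T (Imp B C) -> T (Imp A C).
Proof.
  intros HAB HBC. apply (theory_imp_mp A B); [|exact HAB].
  apply theory_weaken, HBC.
Qed.

Lemma theory_or_imp A B C : T (Imp A C) -> T (Imp B C) -> T (Imp (Or A B) C).
Proof.
  intros HAC. apply (theory_mp T HT). revert HAC.
  apply (theory_mp T HT), theory_ipl, ipl_or_e.
Qed.

Lemma theory_and A B : T (And A B) <-> T A /\ T B.
Proof.
  split.
  - intros H. split; revert H; apply (theory_mp T HT), theory_ipl; constructor.
  - intros [HA HB]. apply (theory_mp T HT B); [|exact HB].
    apply (theory_mp T HT A); [|exact HA]. apply theory_ipl, ipl_and_i.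
Qed.

Lemma theory_contradiction A B : T (Neg A) -> T A -> T B.
Proof.
  intros H. apply (theory_mp T HT). revert H.
  apply (theory_mp T HT), theory_ipl, ipl_neg_e.
Qed.

Lemma theory_imp_neg A : T (Imp A (Neg A)) -> T (Neg A).
Proof.
  intros H. apply (theory_mp T HT (Imp A (Neg A))); [|exact H].
  apply (theory_mp T HT (Imp A A)); [|apply theory_imp_refl].
  apply theory_ipl, ipl_neg_i.
Qed.

(** In view of the deduction theorem, this is the theory generated by [T] and [A]. *)
Lemma theory_adjoin A : theory (fun B => T (Imp A B)).
Proof.
  split.
  - intros B HB. apply theory_weaken, (theory_thm T HT), HB.
  - intros B C. apply theory_imp_mp.
Qed.

End Theory.

Lemma prime_or_iff T : prime T -> forall A B, T (Or A B) <-> T A \/ T B.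
Proof.
  intros HT A B. pose proof (prime_theory T HT) as HT'. split.
  - apply (prime_or T HT).
  - intros [H|H]; revert H; apply (theory_mp T HT'), (theory_ipl T HT');
      constructor.
Qed.

Lemma Int2GC_theory : theory Int2GC.
Proof. split; [trivial|exact int2gc_mp]. Qed.

(** * Coding of formulas and prime separation *)

Fixpoint code (A : form) : nat :=
  match A with
  | Var p => to_nat (0, p)
  | Neg A => to_nat (1, code A)
  | Or A B => to_nat (2, to_nat (code A, code B))
  | And A B => to_nat (3, to_nat (code A, code B))
  | Imp A B => to_nat (4, to_nat (code A, code B))
  | BUp A => to_nat (5, code A)
  | BDown A => to_nat (6, code A)
  | WUp A => to_nat (7, code A)
  | WDown A => to_nat (8, code A)
  end.

Lemma to_nat_pair_inj a b c d :
  to_nat (a, b) = to_nat (c, d) -> a = c /\ b = d.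
Proof. intros H. apply to_nat_inj in H. injection H. auto. Qed.

Lemma code_inj (A B : form) : code A = code B -> A = B.
Proof.
  revert B.
  induction A; intros []; cbn [code]; intros H;
    apply to_nat_pair_inj in H; destruct H as [Ht H];
    try discriminate Ht; try (apply to_nat_pair_inj in H; destruct H);
    f_equal; auto.
Qed.

Section Separation.

Variables (T I : form -> Prop).
Hypotheses (HT : theory T) (HI : ideal I).
Hypotheses (I_inh : exists A, I A) (disj : forall A, T A -> ~ I A).

(* Stage [n] decides the formula of code [n], if there is one: it is adjoined
   when the resulting theory still avoids [I]. *)
Fixpoint stage (n : nat) : form -> Prop :=
  match n with
  | O => T
  | S n => fun B => stage n B \/
      exists A, code A = n /\ stage n (Imp A B) /\
        forall C, I C -> ~ stage n (Imp A C)
  end.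

Lemma stage_theory n : theory (stage n).
Proof.
  induction n as [|n IH]; [exact HT|]. simpl. split.
  - intros A HA. left. apply (theory_thm _ IH), HA.
  - intros A B [HAB|(C & cC & HAB & HC)] [HA|(D & cD & HA & HD)].
    + left. exact (theory_mp _ IH A B HAB HA).
    + right. exists D. repeat split; [exact cD| |exact HD].
      apply (theory_imp_mp _ IH D A); [|exact HA].
      apply (theory_weaken _ IH), HAB.
    + right. exists C. repeat split; [exact cC| |exact HC].
      apply (theory_imp_mp _ IH C A); [exact HAB|].
      apply (theory_weaken _ IH), HA.
    + right. exists C. repeat split; [exact cC| |exact HC].
      (* By injectivity of [code], at most one formula is adjoined per stage. *)
      assert (E : D = C) by (apply code_inj; congruence). subst D.
      exact (theory_imp_mp _ IH C A B HAB HA).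
Qed.

Lemma stage_disj n A : stage n A -> ~ I A.
Proof.
  revert A. induction n as [|n IH]; simpl; intros A; [apply disj|].
  intros [HA|(B & _ & HBA & HB)]; [exact (IH A HA)|].
  intros IA. exact (HB A IA HBA).
Qed.

Lemma stage_mono m n A : m <= n -> stage m A -> stage n A.
Proof. induction 1; simpl; auto. Qed.

(** A rejected formula leaves a certificate: a member of [I] that it implies over the stage.
    Primeness of the limit is derived from such certificates. *)
Lemma stage_decides A n :
  code A = n -> stage (S n) A \/ exists C, I C /\ stage n (Imp A C).
Proof.
  intros cA.
  destruct (classic (exists C, I C /\ stage n (Imp A C))) as [H|H]; [auto|].
  left. right. exists A. repeat split; [exact cA| |].
  - apply (theory_imp_refl _ (stage_theory n)).
  - intros C IC HC. apply H. exists C. split; assumption.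
Qed.

Lemma stage_limit_theory : theory (fun A => exists n, stage n A).
Proof.
  split.
  - intros A HA. exists 0. apply (theory_thm T HT), HA.
  - intros A B [m Hm] [n Hn]. exists (Nat.max m n).
    apply (theory_mp _ (stage_theory (Nat.max m n)) A).
    + exact (stage_mono m _ _ (PeanoNat.Nat.le_max_l m n) Hm).
    + exact (stage_mono n _ _ (PeanoNat.Nat.le_max_r m n) Hn).
Qed.

Lemma separation :
  exists P, prime P /\ (forall A, T A -> P A) /\ (forall A, P A -> ~ I A).
Proof.
  pose proof stage_limit_theory as HP.
  assert (Pdisj : forall A, (exists n, stage n A) -> ~ I A).
  { intros A [n Hn]. exact (stage_disj n A Hn). }
  exists (fun A => exists n, stage n A). repeat split.
  - apply HP.
  - apply HP.
  - intros A B HAB.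
    destruct (stage_decides A _ eq_refl) as [HA|(C & IC & HC)]; [eauto|].
    destruct (stage_decides B _ eq_refl) as [HB|(D & ID & HD)]; [eauto|].
    (* If both disjuncts were rejected, their certificates [C] and [D] put [Or C D] into the limit
       as well as into [I]. *)
    exfalso. apply (Pdisj (Or C D)); [|exact (ideal_or I HI C D IC ID)].
    refine (theory_mp _ HP _ _ _ HAB). apply (theory_or_imp _ HP).
    + apply (theory_imp_trans _ HP _ C); [eauto|].
      apply (theory_ipl _ HP), ipl_or_l.
    + apply (theory_imp_trans _ HP _ D); [eauto|].
      apply (theory_ipl _ HP), ipl_or_r.
  - destruct I_inh as [A IA]. exists A. intros HA. exact (Pdisj A HA IA).
  - intros A HA. exists 0. exact HA.
  - exact Pdisj.
Qed.

End Separation.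

Lemma separation_formula (T : form -> Prop) (A : form) :
  theory T -> ~ T A ->
  exists P, prime P /\ (forall B, T B -> P B) /\ ~ P A.
Proof.
  intros HT HA. pose proof Int2GC_theory as H0.
  (* The principal ideal of the formulas that provably imply [A]. *)
  destruct (separation T (fun B => Int2GC (Imp B A))) as (P & HP & TP & PI).
  - exact HT.
  - split; intros B C; [exact (theory_imp_trans _ H0 B C A)|].
    exact (theory_or_imp _ H0 B C A).
  - exists A. apply (theory_imp_refl _ H0).
  - intros B HB HBA. apply HA.
    apply (theory_mp T HT B); [apply (theory_thm T HT), HBA|exact HB].
  - exists P. repeat split; try apply HP; [exact TP|].
    intros PA. apply (PI A PA), (theory_imp_refl _ H0).
Qed.

(** * Adjoint pairs of connectives *)

Definition adjoint (f g : form -> form) : Prop :=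
  forall A B, Int2GC (Imp (f A) B) <-> Int2GC (Imp A (g B)).

Lemma BUp_WDown_adjoint : adjoint BUp WDown.
Proof. intros A B. split; constructor; assumption. Qed.

Lemma WUp_BDown_adjoint : adjoint WUp BDown.
Proof. intros A B. split; constructor; assumption. Qed.

Definition canonical_rel (f : form -> form) (T U : form -> Prop) : Prop :=
  forall A, U A -> T (f A).

Section Adjoint.

Variables (f g : form -> form).
Hypothesis fg : adjoint f g.

Let imp_refl := theory_imp_refl Int2GC Int2GC_theory.
Let imp_trans := theory_imp_trans Int2GC Int2GC_theory.

Lemma adjoint_unit A : Int2GC (Imp A (g (f A))).
Proof. apply fg, imp_refl. Qed.

Lemma adjoint_counit A : Int2GC (Imp (f (g A)) A).
Proof. apply fg, imp_refl. Qed.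

Lemma adjoint_left_mono A B :
  Int2GC (Imp A B) -> Int2GC (Imp (f A) (f B)).
Proof.
  intros H. apply fg. exact (imp_trans _ _ _ H (adjoint_unit B)).
Qed.

(** Left adjoints preserve joins: after transposing, each disjunct reduces to a disjunction
    introduction. *)
Lemma adjoint_left_or A B : Int2GC (Imp (f (Or A B)) (Or (f A) (f B))).
Proof.
  apply fg, (theory_or_imp _ Int2GC_theory); apply fg, int2gc_ipl; constructor.
Qed.

(** Necessitation for [g], transposed from [f (Imp A A)] implying the theorem [A]. *)
Lemma adjoint_right_thm A : Int2GC A -> Int2GC (g A).
Proof.
  intros H. apply (int2gc_mp (Imp A A)); [|apply imp_refl].
  apply fg, (theory_weaken _ Int2GC_theory), H.
Qed.

(** The K axiom for [g]. For the conjunction [C] of the two premises, transposing the projections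
    shows that [f C] implies both [Imp A B] and [A], hence [B]; transposing back and currying
    finishes. *)
Lemma adjoint_right_imp A B :
  Int2GC (Imp (g (Imp A B)) (Imp (g A) (g B))).
Proof.
  set (C := And (g (Imp A B)) (g A)).
  assert (HC : Int2GC (Imp C (g B))).
  { apply fg. apply (theory_imp_mp _ Int2GC_theory _ A); apply fg;
      apply int2gc_ipl; constructor. }
  apply (imp_trans _ (Imp (g A) C)); [apply int2gc_ipl, ipl_and_i|].
  apply (int2gc_mp (Imp (g A) (Imp C (g B)))); [apply int2gc_ipl, ipl_s|].
  apply (theory_weaken _ Int2GC_theory), HC.
Qed.

Lemma adjoint_right_theory T : theory T -> theory (fun A => T (g A)).
Proof.
  intros HT. split.
  - intros A HA. apply (theory_thm T HT), adjoint_right_thm, HA.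
  - intros A B H. apply (theory_mp T HT). revert H.
    apply (theory_mp T HT), (theory_thm T HT), adjoint_right_imp.
Qed.

(** The counit gives one direction and the unit the other. *)
Lemma canonical_rel_right T U :
  theory T -> theory U ->
  (canonical_rel f T U <-> forall A, U (g A) -> T A).
Proof.
  intros HT HU. split; intros H A HA.
  - apply (theory_mp T HT (f (g A))); [|exact (H _ HA)].
    apply (theory_thm T HT), adjoint_counit.
  - apply H, (theory_mp U HU A); [|exact HA].
    apply (theory_thm U HU), adjoint_unit.
Qed.

Lemma prime_left T A :
  prime T -> (T (f A) <-> exists U, prime U /\ canonical_rel f T U /\ U A).
Proof.
  intros HT. pose proof (prime_theory T HT) as HT'.
  assert (mono : forall B C, Int2GC (Imp B C) -> T (f B) -> T (f C)).
  { intros B C HBC.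
    apply (theory_mp T HT'), (theory_thm T HT'), adjoint_left_mono, HBC. }
  split; [|intros (U & _ & TU & UA); exact (TU A UA)].
  intros TA.
  destruct (separation (fun B => Int2GC (Imp A B)) (fun B => ~ T (f B)))
    as (U & HU & AU & UT).
  - apply (theory_adjoin _ Int2GC_theory).
  - split.
    + intros B C HBC HC HB. exact (HC (mono B C HBC HB)).
    + intros B C HB HC HBC.
      assert (H : T (Or (f B) (f C))).
      { revert HBC.
        apply (theory_mp T HT'), (theory_thm T HT'), adjoint_left_or. }
      destruct (prime_or T HT _ _ H); auto.
  (* The ideal has a member because [f] preserves falsity: [f] of a contradiction implies every
     formula, in particular some [C] outside [T]. *)
  - destruct (prime_proper T HT) as [C HC].
    exists (And C (Neg C)). intros H. apply HC. revert H.
    apply (theory_mp T HT'), (theory_thm T HT').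
    apply fg. set (D := And C (Neg C)).
    pose proof (theory_adjoin _ Int2GC_theory D) as HD.
    apply (theory_contradiction _ HD C); apply int2gc_ipl; constructor.
  - intros B HAB HB. exact (HB (mono A B HAB TA)).
  - exists U. split; [exact HU|]. split; [|apply AU, imp_refl].
    intros B UB. apply NNPP, (UT B UB).
Qed.

Lemma prime_right T A :
  prime T ->
  (T (g A) <-> forall U, prime U -> canonical_rel f U T -> U A).
Proof.
  intros HT. pose proof (prime_theory T HT) as HT'. split.
  - intros TA U HU TU. revert A TA.
    apply canonical_rel_right; [apply HU|apply HT|exact TU].
  - intros H. apply NNPP. intros TA.
    (* Any prime extension of the preimage of [T] under [g] is related to [T], by
       [canonical_rel_right]; one omitting [A] is chosen. *)
    destruct (separation_formula (fun B => T (g B)) A) as (U & HU & TU & UA).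
    + apply adjoint_right_theory, HT'.
    + exact TA.
    + apply UA, (H U HU).
      apply canonical_rel_right; [apply HU|apply HT|exact TU].
Qed.

End Adjoint.

(** * Implication and negation in prime theories *)

Lemma prime_imp T A B :
  prime T ->
  (T (Imp A B) <->
   forall U, prime U -> (forall C, T C -> U C) -> U A -> U B).
Proof.
  intros HT. pose proof (prime_theory T HT) as HT'. split.
  - intros H U HU TU. apply (theory_mp U (prime_theory U HU)), TU, H.
  - intros H. apply NNPP. intros HAB.
    destruct (separation_formula _ B (theory_adjoin T HT' A) HAB)
      as (U & HU & TU & UB).
    apply UB, (H U HU).
    + intros C TC. apply TU, (theory_weaken T HT'), TC.
    + apply TU, (theory_imp_refl T HT').
Qed.

Lemma prime_neg T A :
  prime T ->
  (T (Neg A) <-> forall U, prime U -> (forall C, T C -> U C) -> ~ U A).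
Proof.
  intros HT. pose proof (prime_theory T HT) as HT'. split.
  - intros H U HU TU UA. destruct (prime_proper U HU) as [C UC].
    apply UC, (theory_contradiction U (prime_theory U HU) A);
      [apply TU, H|exact UA].
  - intros H. apply NNPP. intros HA.
    (* Adjoining [A] to [T] does not yield [Neg A], since [Imp A (Neg A)] already gives [Neg A] in
       [T]. So some prime extension of [T] contains [A]. *)
    destruct (separation_formula _ (Neg A) (theory_adjoin T HT' A))
      as (U & HU & TU & _).
    + intros H'. apply HA, (theory_imp_neg T HT'), H'.
    + apply (H U HU).
      * intros C TC. apply TU, (theory_weaken T HT'), TC.
      * apply TU, (theory_imp_refl T HT').
Qed.

(** * The canonical model and completeness *)

Definition canonical_world : Type := { T : form -> Prop | prime T }.

Definition canonical_le : relation canonical_world :=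
  fun x y => forall A, proj1_sig x A -> proj1_sig y A.

Lemma canonical_le_preorder : preorder canonical_world canonical_le.
Proof. split; unfold reflexive, transitive, canonical_le; auto. Qed.

Definition canonical_R1 : relation canonical_world :=
  fun x y => canonical_rel BUp (proj1_sig x) (proj1_sig y).

(** The arguments are swapped relative to [canonical_R1] because [WUp] looks backwards along its
    relation, whereas [BUp] looks forwards. *)
Definition canonical_R2 : relation canonical_world :=
  fun x y => canonical_rel WUp (proj1_sig y) (proj1_sig x).

Lemma canonical_R1_closed :
  inclusion canonical_world
    (rel_comp (rel_comp (transp canonical_world canonical_le) canonical_R1)
       (transp canonical_world canonical_le)) canonical_R1.
Proof. intros x y (z & (w & wx & wz) & yz) A HA. apply wx, wz, yz, HA. Qed.

Lemma canonical_R2_closed :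
  inclusion canonical_world
    (rel_comp (rel_comp canonical_le canonical_R2) canonical_le) canonical_R2.
Proof. intros x y (z & (w & xw & wz) & zy) A HA. apply zy, wz, xw, HA. Qed.

(** Inhabitedness is a parameter; in [completeness] the prime theory omitting the unprovable formula
    supplies it. *)
Definition canonical_frame (inh : inhabited canonical_world) : frame :=
  Frame canonical_world inh canonical_le canonical_R1 canonical_R2
    canonical_le_preorder canonical_R1_closed canonical_R2_closed.

Definition canonical_valuation (inh : inhabited canonical_world) :
  valuation (canonical_frame inh) :=
  Valuation (canonical_frame inh)
    (fun p (x : canonical_world) => proj1_sig x (Var p))
    (fun p x y Hx xy => xy (Var p) Hx).

Lemma truth (inh : inhabited canonical_world) (A : form) :
  forall x : canonical_world,
    sat (canonical_frame inh) (canonical_valuation inh) x A <-> proj1_sig x A.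
Proof.
  induction A as [p|A IHA|A IHA B IHB|A IHA B IHB|A IHA B IHB
                 |A IHA|A IHA|A IHA|A IHA]; simpl; intros [T HT]; simpl.
  - reflexivity.
  - rewrite (prime_neg T A HT). split.
    + intros H U HU TU UA. apply (H (exist _ U HU) TU), IHA, UA.
    + intros H [U HU] TU UA. apply (H U HU TU). apply IHA in UA. exact UA.
  - rewrite IHA, IHB. symmetry. apply (prime_or_iff T HT).
  - rewrite IHA, IHB. symmetry. apply (theory_and T (prime_theory T HT)).
  - rewrite (prime_imp T A B HT). split.
    + intros H U HU TU UA. apply (IHB (exist _ U HU)), H, IHA, UA. exact TU.
    + intros H [U HU] TU UA. apply IHB, (H U HU TU). apply IHA in UA. exact UA.
  - rewrite (prime_left BUp WDown BUp_WDown_adjoint T A HT). split.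
    + intros ([U HU] & TU & UA). exists U. apply IHA in UA. auto.
    + intros (U & HU & TU & UA). exists (exist _ U HU). split; [exact TU|].
      apply IHA, UA.
  - rewrite (prime_right WUp BDown WUp_BDown_adjoint T A HT). split.
    + intros H U HU TU. apply (IHA (exist _ U HU)), H, TU.
    + intros H [U HU] TU. apply IHA, (H U HU TU).
  - rewrite (prime_left WUp BDown WUp_BDown_adjoint T A HT). split.
    + intros ([U HU] & TU & UA). exists U. apply IHA in UA. auto.
    + intros (U & HU & TU & UA). exists (exist _ U HU). split; [exact TU|].
      apply IHA, UA.
  - rewrite (prime_right BUp WDown BUp_WDown_adjoint T A HT). split.
    + intros H U HU TU. apply (IHA (exist _ U HU)), H, TU.
    + intros H [U HU] TU. apply IHA, (H U HU TU).
Qed.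

Lemma completeness (A : form) : kripke_valid A -> Int2GC A.
Proof.
  intros HA. apply NNPP. intros nA.
  destruct (separation_formula Int2GC A Int2GC_theory nA)
    as (T & HT & _ & TA).
  set (x := exist _ T HT : canonical_world).
  apply TA, (truth (inhabits x) A x), HA.
Qed.

Theorem theorem4p5 (A : form) : Int2GC A <-> kripke_valid A.
Proof. split; [apply soundness|apply completeness]. Qed.
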